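(* Suppose that $$\lim_{n \rightarrow \infty} \frac{1}{n^2} \sum_{k=1}^n p_k \sigma_k^2 = 0.$$ Then $\overline{X}_n$ converges in probability to $\mu$ as $n \to \infty$.
   Context: Let $F$ be a cumulative distribution function on $\mathbb{R}$ with $\int_{-\infty}^\infty x\, dF(x) = 0$ and $\int_{-\infty}^\infty x^2\, dF(x) = 1$. Fix $\mu \in \mathbb{R}$, and for each integer $k \geq 1$ let $p_k \in [0,1]$ and $\sigma_k \in [1,\infty)$. Let $X_1, X_2, \ldots$ be independent random variables such that, for each $k$, $X_k$ has cumulative distribution function $x \mapsto (1-p_k) F(x-\mu) + p_k F\left(\frac{x-\mu}{\sigma_k}\right)$. Put $\overline{X}_n = \frac{1}{n} \sum_{k=1}^n X_k$. *)

(* Defs.v *)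
From HB Require Import structures.
From mathcomp Require Import all_boot all_order all_algebra finmap.
From mathcomp Require Import all_classical all_reals all_analysis measurable_realfun.

Set Implicit Arguments.
Unset Strict Implicit.
Unset Printing Implicit Defensive.

Import Order.TTheory GRing.Theory Num.Theory.
Import numFieldNormedType.Exports.

Local Open Scope classical_set_scope.
Local Open Scope ring_scope.

(* Mutual independence of the subfamily of X indexed by the set D. *)
Definition mutually_independent (d : measure_display) (T : measurableType d)
    (R : realType) (P : probability T R) (I : choiceType) (D : set I)
    (X : I -> {RV P >-> R}) : Prop :=
  forall (J : {fset I}) (A : I -> set R),
    [set` J] `<=` D -> (forall i, i \in J -> measurable (A i)) ->
    P (\bigcap_(i in [set` J]) (X i @^-1` A i)) =
    (\prod_(i <- J) P (X i @^-1` A i))%E.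

Definition cvg_in_probability (d : measure_display) (T : measurableType d)
    (R : realType) (P : probability T R) (Y : nat -> {RV P >-> R})
    (Z : {RV P >-> R}) : Prop :=
  forall eps : R, 0 < eps ->
    P [set t | eps < `|Y n t - Z t|] @[n --> \oo] --> 0%E.

(* The family is indexed from 1: X 0 is not used, and sample_mean X 0 = 0. *)
Definition sample_mean (d : measure_display) (T : measurableType d)
    (R : realType) (P : probability T R) (X : nat -> {RV P >-> R}) (n : nat) :
    {RV P >-> R} :=
  n%:R^-1 *: \sum_(1 <= k < n.+1) X k.

(* Main.v *)
Require Import Defs.
From HB Require Import structures.
From mathcomp Require Import all_boot all_order all_algebra finmap.
From mathcomp Require Import all_classical all_reals all_analysis measurable_realfun.

Import Order.TTheory GRing.Theory Num.Theory.
Import numFieldNormedType.Exports.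

Local Open Scope classical_set_scope.
Local Open Scope ring_scope.

(** The proof is Chebyshev's inequality for uncorrelated summands.  The law of
    [X k] is the mixture, with weights [1 - p k] and [p k], of the laws of
    [mu + Z] and [mu + sigma k * Z], where [Z] has distribution function [F]:
    both sides have the same distribution function, and rays determine a finite
    measure on the line ([eq_measure_rays], [ge0_integral_mixture]).  Integrating
    against the mixture, [X k] has mean [mu] and variance
    [1 - p k + p k * sigma k ^+ 2] ([contaminated_mean],
    [contaminated_moment2]).

    Independence turns the joint law of two variables into a product measure, so
    that Fubini's theorem gives [expectation_indep_mul] and hence zero
    covariance.  The variance of the sample mean is then
    [n^-2 * \sum_(1 <= k < n.+1) (1 - p k + p k * sigma k ^+ 2)], which lies
    between [0] and [n^-1 + n^-2 * \sum_(1 <= k < n.+1) p k * sigma k ^+ 2]; this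
    bound tends to [0] by hypothesis, and [weak_law_uncorrelated] concludes. *)

(** * Laws on the line and their distribution functions *)

(** Open right rays form a pi-system that generates the Borel sets; equal total
    mass transfers the hypothesis from closed left rays to their complements. *)
Lemma eq_measure_rays (R : realType) (m1 m2 : {measure set R -> \bar R}) :
  (m1 setT < +oo)%E -> m1 setT = m2 setT ->
  (forall r : R, m1 `]-oo, r]%classic = m2 `]-oo, r]%classic) ->
  forall A, measurable A -> m1 A = m2 A.
Proof.
move=> m1oo m12T m12.
have m1fin A : measurable A -> (m1 A < +oo)%E.
  by move=> mA; apply: le_lt_trans m1oo; rewrite le_measure ?inE.
have oray (m : {measure set R -> \bar R}) (r : R) : (m setT < +oo)%E ->
    m `]r, +oo[%classic = (m setT - m `]-oo, r]%classic)%E.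
  by move=> moo; rewrite -setCitvl -setTD measureD// setTI.
(* An exhausting sequence of rays of finite measure. *)
move=> A mA; pose g (n : nat) : set R := `](- n%:R : R), +oo[%classic.
refine (@measure_unique _ R R (@RGenOInfty.G R) g _ _ _ _ m1 m2 _ _ A mA).
- exact: RGenOInfty.measurableE.
- move=> _ _ [x ->] [y ->]; exists (Num.max x y).
  by apply/seteqP; split=> z /=; rewrite !in_itv/= !andbT gt_max => /andP.
- by move=> i; exists (- i%:R).
- rewrite -subTset => x _; exists (Num.bound `|x|) => //.
  rewrite /g/= in_itv/= andbT ltrNl (le_lt_trans (ler_norm _))// normrN.
  exact: (archi_boundP (normr_ge0 x)).
- by move=> _ [x ->]; rewrite !oray -?m12T ?m12.
- by move=> k; apply: m1fin; exact: measurable_itv.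
Qed.

Section mixture.
Local Open Scope ereal_scope.
Context d d' (T : measurableType d) (T' : measurableType d') (R : realType).
Variables (P : probability T R) (Q : probability T' R).
Variables (X : {RV P >-> R}) (Z1 Z2 : {RV Q >-> R}) (a b : {nonneg R}).
Hypothesis ab1 : (a%:num + b%:num = 1)%R.
Hypothesis cdfX : forall r, cdf X r = a%:num%:E * cdf Z1 r + b%:num%:E * cdf Z2 r.

(** An identity between distribution functions is an identity between laws, and
    the integral is linear in the law it is taken against. *)
Lemma ge0_integral_mixture (h : R -> \bar R) : measurable_fun [set: R] h ->
  (forall r, 0 <= h r) ->
  \int[P]_t h (X t) =
    a%:num%:E * \int[Q]_t h (Z1 t) + b%:num%:E * \int[Q]_t h (Z2 t).
Proof.
move=> mh h0.
rewrite -[LHS](@ge0_integral_distribution _ _ _ _ _ P X h mh h0).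
rewrite -(@ge0_integral_distribution _ _ _ _ _ Q Z1 h mh h0).
rewrite -(@ge0_integral_distribution _ _ _ _ _ Q Z2 h mh h0).
rewrite -!ge0_integral_mscale// -ge0_integral_measure_add//.
apply: eq_measure_integral => A mA _.
pose m := measure_add (mscale a (distribution Q Z1)) (mscale b (distribution Q Z2)).
have mE B : m B = a%:num%:E * distribution Q Z1 B + b%:num%:E * distribution Q Z2 B.
  exact: measure_addE.
apply: (@eq_measure_rays R (distribution P X) m) => //.
- by rewrite /= probability_setT ltry.
- have T1 W : distribution Q W setT = 1 := probability_setT (distribution Q W).
  rewrite [LHS](probability_setT (distribution P X)) [RHS]mE !T1.
  by rewrite !mule1 -EFinD ab1.
- by move=> r; rewrite [RHS]mE; exact: cdfX.
Qed.

End mixture.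

Lemma lebesgue_stieltjes_ray (R : realType) (F : cumulativeBounded (0 : R) (1 : R))
  (r : R) : lebesgue_stieltjes_measure F `]-oo, r]%classic = (F r)%:E.
Proof.
rewrite -(cdf_lebesgue_stieltjes_id F r).
by rewrite /cdf /distribution /pushforward preimage_id.
Qed.

Section affine.
Context (R : realType).

(** The domain carries the Borel structure generated by the half-open
    intervals, on which Lebesgue-Stieltjes measures are built, so that [affine]
    is a random variable for them. *)
Definition affine (mu s : R) : measurableTypeR R -> R := fun x => mu + s * x.

Lemma measurable_affine mu s : measurable_fun setT (affine mu s).
Proof.
by apply: measurable_funD => //; apply: measurable_funM.
Qed.

HB.instance Definition _ mu s :=
  isMeasurableFun.Build _ _ _ _ (affine mu s) (measurable_affine mu s).

Lemma cdf_affine (F : cumulativeBounded (0 : R) (1 : R)) mu s (r : R) : 0 < s ->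
  cdf (affine mu s : {RV lebesgue_stieltjes_measure F >-> R}) r
    = (F ((r - mu) / s))%:E.
Proof.
move=> s0; rewrite /cdf /distribution /pushforward.
rewrite -lebesgue_stieltjes_ray; congr (lebesgue_stieltjes_measure F _).
apply/seteqP; split=> x /=; rewrite !in_itv/= /affine.
  by rewrite ler_pdivlMr// lerBrDl mulrC.
by rewrite ler_pdivlMr// lerBrDl mulrC.
Qed.

End affine.
Arguments affine {R}.

(** * Moments of a contaminated location-scale law *)

Section contaminated_moments.
Local Open Scope ereal_scope.
Context d (T : measurableType d) (R : realType) (P : probability T R).
Variables (F : cumulativeBounded (0 : R) (1 : R)) (X : {RV P >-> R}).
Variables (mu p s : R).
Hypotheses (p01 : (0 <= p <= 1)%R) (s0 : (0 < s)%R).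
Hypothesis cdfX : forall x : R,
  cdf X x = ((1 - p) * F (x - mu) + p * F ((x - mu) / s))%:E.

Local Notation dF := (lebesgue_stieltjes_measure F).

Lemma ge0_integral_contaminated (h : R -> \bar R) : measurable_fun [set: R] h ->
  (forall r, 0 <= h r) ->
  \int[P]_t h (X t) =
    (1 - p)%:E * \int[dF]_x h (mu + x)%R + p%:E * \int[dF]_x h (mu + s * x)%R.
Proof.
move=> mh h0; have /andP[p0 p1] := p01.
have q0 : (0 <= 1 - p)%R by rewrite subr_ge0.
rewrite (@ge0_integral_mixture _ _ _ _ _ P dF X (affine mu 1) (affine mu s)
  (NngNum q0) (NngNum p0))//=; first last.
- move=> r; apply: (@etrans _ _ (
    (1 - p)%:E * cdf (affine mu 1 : {RV dF >-> R}) r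
    + p%:E * cdf (affine mu s : {RV dF >-> R}) r)) => //.
  rewrite !cdf_affine// divr1.
  by rewrite -!EFinM -EFinD cdfX.
- by rewrite subrK.
congr (_ * _ + _).
by apply: eq_integral => x _; rewrite /affine mul1r.
Qed.

(** Scaling by [s] multiplies [h] by a constant both for the square, with
    [c = s ^+ 2], and for the positive and negative parts, with [c = s]; this
    one computation therefore yields the first two moments. *)
Lemma ge0_integral_contaminated_homogeneous (h : R -> \bar R) (c : R) :
  measurable_fun [set: R] h -> (forall r, 0 <= h r) -> (0 <= c)%R ->
  (forall x, h (s * x)%R = c%:E * h x) ->
  \int[P]_t h (X t - mu)%R = (1 - p + p * c)%:E * \int[dF]_x h x.
Proof.
move=> mh h0 c0 hc; have /andP[p0 p1] := p01.
have msub : measurable_fun [set: R] (fun r : R => h (r - mu)%R).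
  apply: (@measurableT_comp _ _ _ _ _ _ h) => //.
  exact: measurable_funB.
rewrite (ge0_integral_contaminated (fun r => h (r - mu)%R) msub)//.
have -> : \int[dF]_x h (mu + x - mu)%R = \int[dF]_x h x.
  by apply: eq_integral => x _; rewrite addrC addKr.
have -> : \int[dF]_x h (mu + s * x - mu)%R = c%:E * \int[dF]_x h x.
  rewrite -ge0_integralZl//.
  by apply: eq_integral => x _; rewrite addrC addKr hc.
by rewrite (EFinD (1 - p)%R) EFinM [RHS]ge0_muleDl ?muleA// lee_fin ?subr_ge0 ?mulr_ge0//.
Qed.

Hypothesis dF_mean : \int[dF]_x x%:E = 0.
Hypothesis dF_moment2 : \int[dF]_x (x ^+ 2)%:E = 1.

Lemma contaminated_moment2 :
  \int[P]_t ((X t - mu) ^+ 2)%:E = (1 - p + p * s ^+ 2)%:E.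
Proof.
rewrite (ge0_integral_contaminated_homogeneous (fun r => (r ^+ 2)%:E) (s ^+ 2))//.
- by rewrite dF_moment2 mule1.
- apply/measurable_EFinP; exact: measurable_funX.
- by move=> r; rewrite lee_fin sqr_ge0.
- by rewrite sqr_ge0.
- by move=> x; rewrite exprMn EFinM.
Qed.

(** Positive and negative parts are rescaled by the same factor, so the mean
    remains [0] after contamination. *)
Lemma contaminated_mean : \int[P]_t (X t - mu)%:E = 0.
Proof.
have s0' := ltW s0.
pose A := \int[dF]_x EFin^\+ x; pose B := \int[dF]_x EFin^\- x.
have posE : \int[P]_t (fun t => (X t - mu)%:E)^\+ t = (1 - p + p * s)%:E * A.
  transitivity (\int[P]_t EFin^\+ (X t - mu)%R).
    by apply: eq_integral => t _; rewrite !funeposE.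
  rewrite (ge0_integral_contaminated_homogeneous (EFin^\+) s)//.
    by apply: measurable_funepos; apply/measurable_EFinP.
  by move=> x; rewrite !funeposE maxe_pMr// mule0.
have negE : \int[P]_t (fun t => (X t - mu)%:E)^\- t = (1 - p + p * s)%:E * B.
  transitivity (\int[P]_t EFin^\- (X t - mu)%R).
    by apply: eq_integral => t _; rewrite !funenegE.
  rewrite (ge0_integral_contaminated_homogeneous (EFin^\-) s)//.
    by apply: measurable_funeneg; apply/measurable_EFinP.
  by move=> x; rewrite !funenegE maxe_pMr// mule0 muleN.
have B0 : 0 <= B by apply: integral_ge0.
have AB0 : A - B = 0 by rewrite -[RHS]dF_mean integralE.
(* Subtracting +oo always yields -oo, so a mean equal to 0 forces the negative
   part to have a finite integral, which is what distributivity requires. *)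
have Bfin : B \is a fin_num.
  by rewrite ge0_fin_numE// ltey; apply/eqP => Boo; move: AB0; rewrite Boo addeNy.
rewrite integralE posE negE -muleBr// ?AB0 ?mule0//.
by rewrite fin_num_adde_defl// fin_numN.
Qed.

End contaminated_moments.

(** * Independence and covariance *)

Lemma Lfun2_sqr_lty d (T : measurableType d) (R : realType)
    (P : {measure set T -> \bar R}) (f : T -> R) :
  measurable_fun setT f -> (\int[P]_t (f t ^+ 2)%:E < +oo)%E -> f \in Lfun P 2%:E.
Proof.
move=> mf f2; rewrite inE; apply/andP; split; rewrite inE//=.
rewrite /finite_norm unlock /=; apply: poweR_lty.
under eq_integral do rewrite powR_mulrn// -normrX ger0_norm ?sqr_ge0//.
exact: f2.
Qed.

Section independence.
Local Open Scope ereal_scope.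
Context d (T : measurableType d) (R : realType) (P : probability T R).

(** Independence says that the joint law agrees with the product of the
    marginals on rectangles, hence everywhere; Fubini's theorem then separates
    the integral of the product. *)
Lemma expectation_indep_mul (X Y : {RV P >-> R}) :
  (forall A B, measurable A -> measurable B ->
    P (X @^-1` A `&` Y @^-1` B) = P (X @^-1` A) * P (Y @^-1` B)) ->
  (X : T -> R) \in Lfun P 1 -> (Y : T -> R) \in Lfun P 1 ->
  (X \* Y)%R \in Lfun P 1 -> 'E_P[X \* Y] = 'E_P[X] * 'E_P[Y].
Proof.
move=> XY X1 Y1 /Lfun1_integrable XY1.
pose Z (t : T) := (X t, Y t).
have mZ : measurable_fun setT Z by exact: measurable_fun_pair.
have mmul : measurable_fun setT (fun z : R * R => (z.1 * z.2)%:E).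
  by apply/measurable_EFinP; apply: measurable_funM.
have jointE A : measurable A ->
    (distribution P X \x distribution P Y) A = pushforward P Z A.
  pose ZRV : {RV P >-> (R * R)%type} := HB.pack Z (isMeasurableFun.Build _ _ _ _ Z mZ).
  apply: (product_measure_unique (m' := distribution P ZRV)) => B C mB mC.
  exact: XY.
have imul : (distribution P X \x distribution P Y).-integrable setT
    (fun z : R * R => (z.1 * z.2)%:E).
  have jE := eq_measure_integral (pushforward P Z) (fun A mA _ => jointE A mA).
  apply/integrableP; split=> //; rewrite jE.
  by have /integrableP[] := integrable_pushforward mZ mmul XY1 measurableT.
have mulE : \int[distribution P X \x distribution P Y]_z (z.1 * z.2)%:E = 'E_P[X \* Y].
  rewrite (eq_measure_integral (pushforward P Z)); last by move=> A mA _; exact: jointE.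
  rewrite integral_pushforward//.
  by rewrite expectation.unlock.
have EY : \int[distribution P Y]_y y%:E = 'E_P[Y].
  rewrite expectation.unlock integral_distribution//.
  exact/Lfun1_integrable.
have EX : \int[distribution P X]_y y%:E = 'E_P[X].
  rewrite expectation.unlock integral_distribution//.
  exact/Lfun1_integrable.
rewrite -mulE -integral12_prod_meas1//=.
have iX : (distribution P X).-integrable setT (EFin : R -> \bar R).
  apply: integrable_pushforward => //; exact/Lfun1_integrable.
have iY : (distribution P Y).-integrable setT (EFin : R -> \bar R).
  apply: integrable_pushforward => //; exact/Lfun1_integrable.
transitivity (\int[distribution P X]_x (x%:E * 'E_P[Y])).
  by apply: eq_integral => x _; rewrite /fubini_F/= -EY -integralZl.
by rewrite -(fineK (expectation_fin_num Y1)) integralZr// EX.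
Qed.

End independence.

Lemma mutually_independent_pair (d : measure_display) (T : measurableType d)
    (R : realType) (P : probability T R) (I : choiceType) (D : set I)
    (X : I -> {RV P >-> R}) (i j : I) : mutually_independent D X ->
  D i -> D j -> i != j -> forall A B, measurable A -> measurable B ->
  P (X i @^-1` A `&` X j @^-1` B) = (P (X i @^-1` A) * P (X j @^-1` B))%E.
Proof.
move=> indX Di Dj ij A B mA mB.
pose C k := if k == i then A else B.
have Ci : C i = A by rewrite /C eqxx.
have Cj : C j = B by rewrite /C eq_sym (negbTE ij).
have := indX [fset i; j]%fset C.
rewrite big_fsetU1 ?inE//= big_seq_fset1 Ci Cj => <-.
- congr (P _); apply/seteqP; split=> t /=.
    by move=> [At Bt] k /=; rewrite !inE => /orP[]/eqP ->; rewrite /= ?Ci ?Cj.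
  move=> h; split.
    by have := h i; rewrite /= Ci; apply; rewrite !inE eqxx.
  by have := h j; rewrite /= Cj; apply; rewrite !inE eqxx orbT.
- by move=> k /=; rewrite !inE => /orP[]/eqP ->.
- by move=> k _; rewrite /C; case: ifP.
Qed.

Lemma indep_covariance0 d (T : measurableType d) (R : realType)
    (P : probability T R) (X Y : {RV P >-> R}) :
  (forall A B, measurable A -> measurable B ->
    P (X @^-1` A `&` Y @^-1` B) = (P (X @^-1` A) * P (Y @^-1` B))%E) ->
  (X : T -> R) \in Lfun P 2%:E -> (Y : T -> R) \in Lfun P 2%:E ->
  covariance P X Y = 0%E.
Proof.
move=> XY X2 Y2.
have Pfin : P setT \is a fin_num := fin_num_measure P _ measurableT.
have X1 := Lfun_subset12 Pfin X2.
have Y1 := Lfun_subset12 Pfin Y2.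
have XY1 := Lfun2_mul_Lfun1 X2 Y2.
rewrite covarianceE// (expectation_indep_mul _ _ _ _ _ _ XY)// subee//.
by rewrite fin_numM// expectation_fin_num.
Qed.

Lemma variance_sum_uncorrelated (I : eqType) d (T : measurableType d) (R : realType)
    (P : probability T R) (s : seq I) (X : I -> T -> R) :
  uniq s -> (forall i, i \in s -> X i \in Lfun P 2%:E) ->
  {in s &, forall i j, i != j -> covariance P (X i) (X j) = 0%E} ->
  'V_P[\sum_(i <- s) X i] = (\sum_(i <- s) 'V_P[X i])%E.
Proof.
elim: s => [|i s IH] /=; first by rewrite !big_nil variance_cst.
move=> /andP[nis us] X2 cov0.
have X2s j : j \in s -> X j \in Lfun P 2%:E by move=> js; rewrite X2// inE js orbT.
have sum2 (r : seq I) : {subset r <= s} -> \sum_(j <- r) X j \in Lfun P 2%:E.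
  move=> rs; rewrite big_seq; apply: rpred_sum; rewrite ?lee1n// => ? j jr.
  by apply: X2s; exact: rs.
have Xi2 : X i \in Lfun P 2%:E by rewrite X2// mem_head.
have cov0s (r : seq I) : {subset r <= s} -> covariance P (X i) (\sum_(j <- r) X j) = 0%E.
  elim: r => [|j r IHr] rs; first by rewrite big_nil covariance_cst_r.
  have rs' : {subset r <= s} by move=> k kr; rewrite rs// inE kr orbT.
  have js : j \in s by rewrite rs// mem_head.
  rewrite big_cons covarianceDr ?(X2s j) ?sum2// IHr// adde0.
  rewrite cov0 ?mem_head ?inE ?js ?orbT//.
  by apply: contraNneq nis => ->.
rewrite !big_cons varianceD ?sum2// cov0s// mule0 adde0 IH//.
by move=> j k js ks; apply: cov0; rewrite inE ?js ?ks orbT.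
Qed.

(** * The weak law of large numbers *)

(** Chebyshev's inequality, since the sequence assumed to tend to 0 is the
    variance of the sample mean. *)
Lemma weak_law_uncorrelated d (T : measurableType d) (R : realType)
    (P : probability T R) (X : nat -> {RV P >-> R}) (mu : R) (v : nat -> R) :
  (forall k, (1 <= k)%N -> (X k : T -> R) \in Lfun P 2%:E) ->
  (forall k, (1 <= k)%N -> ('E_P[X k] = mu%:E)%E) ->
  (forall k, (1 <= k)%N -> ('V_P[X k] = (v k)%:E)%E) ->
  (forall i j, (1 <= i)%N -> (1 <= j)%N -> i != j ->
     covariance P (X i) (X j) = 0%E) ->
  (n%:R ^+ 2)^-1 * (\sum_(1 <= k < n.+1) v k) @[n --> \oo] --> (0 : R) ->
  cvg_in_probability (sample_mean X) (cst mu).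
Proof.
move=> X2 EX VX cov0 v0 eps eps0.
have Pfin : P setT \is a fin_num := fin_num_measure P _ measurableT.
have kge1 n k : k \in index_iota 1 n.+1 -> (1 <= k)%N.
  by rewrite mem_index_iota => /andP[].
have smE n : (sample_mean X n : T -> R) =
    (n%:R^-1 \o* (\sum_(1 <= k < n.+1) (X k : T -> R)))%R.
  apply/funext => t; rewrite /sample_mean/=.
  rewrite mulrC; congr (_ * _).
  elim: (index_iota _ _) => [|k s IH]; first by rewrite !big_nil.
  by rewrite !big_cons; exact: (congr1 (+%R (X k t)) IH).
have S2 n : (\sum_(1 <= k < n.+1) (X k : T -> R)) \in Lfun P 2%:E.
  rewrite big_seq; apply: rpred_sum; rewrite ?lee1n// => ? k /kge1; exact: X2.
have Vn n : 'V_P[sample_mean X n] =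
    ((n%:R ^+ 2)^-1 * \sum_(1 <= k < n.+1) v k)%:E.
  rewrite smE varianceZ// variance_sum_uncorrelated ?iota_uniq//; last 2 first.
  - by move=> k /kge1; exact: X2.
  - by move=> i j /kge1 i1 /kge1 j1; exact: cov0.
  rewrite exprVn EFinM -sumEFin; congr (_ * _)%E.
  by apply: eq_big_seq => k /kge1; exact: VX.
have En n : (0 < n)%N -> ('E_P[sample_mean X n] = mu%:E)%E.
  move=> n0; rewrite smE expectationZl; last first.
    exact: (Lfun_subset12 Pfin (S2 n)).
  have -> : \sum_(1 <= k < n.+1) (X k : T -> R) =
      \sum_(Y <- [seq (X k : T -> R) | k <- index_iota 1 n.+1]) Y by rewrite big_map.
  rewrite expectation_sum; last first.
    by move=> _ /mapP[k /kge1 k1 ->]; exact: (Lfun_subset12 Pfin (X2 _ k1)).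
  rewrite big_map (eq_big_seq (fun=> mu%:E)); last by move=> k /kge1; exact: EX.
  rewrite sumEFin sumr_const_nat subn1/= -EFinM -[mu *+ n]mulr_natl mulrA mulVf ?mul1r//.
  by rewrite pnatr_eq0 -lt0n.
have bnd : (((eps ^- 2) * ((n%:R ^+ 2)^-1 * \sum_(1 <= k < n.+1) v k))%:E : \bar R)
    @[n --> \oo] --> 0%E.
  apply/cvg_EFin; first by near=> n.
  rewrite -[X in _ --> X](mulr0 (eps ^- 2)).
  exact: (cvgM (cvg_cst _) v0).
apply: (squeeze_cvge _ (cvg_cst 0%E) bnd).
near=> n; rewrite measure_ge0/=.
have n0 : (0 < n)%N by near: n; exact: nbhs_infty_gt.
rewrite EFinM -Vn; apply: le_trans (chebyshev (sample_mean X n) eps0).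
pose D t := `|sample_mean X n t - mu|.
have mD : measurable_fun setT D.
  by apply: measurableT_comp => //; apply: measurable_funB.
have mDI (i : interval R) : measurable (D @^-1` [set` i]).
  by rewrite -[X in measurable X]setTI; exact: mD.
rewrite En// le_measure ?inE//.
- rewrite [X in measurable X](_ : _ = D @^-1` `]eps, +oo[)//.
  by apply/seteqP; split=> t; rewrite /= in_itv/= andbT.
- rewrite [X in measurable X](_ : _ = D @^-1` `[eps, +oo[)//.
  by apply/seteqP; split=> t; rewrite /= in_itv/= andbT.
- by move=> t /= /ltW.
Unshelve. all: by end_near.
Qed.

Theorem theorem4p1 (R : realType) (F : cumulativeBounded (0 : R) (1 : R))
    (F_mean : (\int[lebesgue_stieltjes_measure F]_x x%:E = 0)%E)
    (F_moment2 : (\int[lebesgue_stieltjes_measure F]_x (x ^+ 2)%:E = 1)%E)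
    (mu : R) (p sigma : nat -> R)
    (p01 : forall k, (1 <= k)%N -> 0 <= p k <= 1)
    (sigma_ge1 : forall k, (1 <= k)%N -> 1 <= sigma k)
    (d : measure_display) (T : measurableType d) (P : probability T R)
    (X : nat -> {RV P >-> R})
    (X_indep : mutually_independent [set k | (1 <= k)%N] X)
    (X_cdf : forall k, (1 <= k)%N -> forall x : R,
      cdf (X k) x =
      ((1 - p k) * F (x - mu) + p k * F ((x - mu) / sigma k))%:E)
    (lim0 : (n%:R ^+ 2)^-1 * (\sum_(1 <= k < n.+1) p k * sigma k ^+ 2)
              @[n --> \oo] --> 0) :
  cvg_in_probability (sample_mean X) (cst mu).
Proof.
have X2c k : (1 <= k)%N ->
    (\int[P]_t ((X k t - mu) ^+ 2)%:E = (1 - p k + p k * sigma k ^+ 2)%:E)%E.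
  move=> k1; exact: (contaminated_moment2 _ _ _ _ F (X k) mu (p k) (sigma k)
    (p01 k k1) (lt_le_trans ltr01 (sigma_ge1 k k1)) (X_cdf k k1)).
have Xc0 k : (1 <= k)%N -> (\int[P]_t (X k t - mu)%:E = 0)%E.
  move=> k1; exact: (contaminated_mean _ _ _ _ F (X k) mu (p k) (sigma k)
    (p01 k k1) (lt_le_trans ltr01 (sigma_ge1 k k1)) (X_cdf k k1)).
have Pfin : P setT \is a fin_num := fin_num_measure P _ measurableT.
have Y2 k : (1 <= k)%N -> (fun t => X k t - mu) \in Lfun P 2%:E.
  move=> k1; apply: Lfun2_sqr_lty; first exact: measurable_funB.
  by rewrite X2c// ltry.
have X2 k : (1 <= k)%N -> (X k : T -> R) \in Lfun P 2%:E.
  move=> k1; have -> : (X k : T -> R) = (fun t => X k t - mu) \+ cst mu.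
    by apply/funext => t /=; rewrite subrK.
  by rewrite rpredD ?lee1n//= => _; [exact: Y2 | exact: Lfun_cst].
have EX k : (1 <= k)%N -> ('E_P[X k] = mu%:E)%E.
  move=> k1; have -> : (X k : T -> R) = (fun t => X k t - mu) \+ cst mu.
    by apply/funext => t /=; rewrite subrK.
  rewrite expectationD ?Lfun_cst//; last exact: (Lfun_subset12 Pfin (Y2 k k1)).
  by rewrite expectation_cst expectation.unlock Xc0// add0e.
apply: (weak_law_uncorrelated _ _ _ _ _ _ (fun k => 1 - p k + p k * sigma k ^+ 2)) => //.
- move=> k k1; rewrite /variance covariance.unlock EX//= expectation.unlock.
  by rewrite -X2c//; apply: eq_integral => t _; rewrite expr2.
- move=> i j i1 j1 ij; apply: indep_covariance0; [|exact: X2..].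
  exact: (mutually_independent_pair _ _ _ _ _ _ _ _ _ X_indep i1 j1 ij).
have inv0 : (n%:R^-1 : R) @[n --> \oo] --> (0 : R).
  apply/gtr0_cvgV0; last exact: cvgr_idn.
  by near=> n; rewrite ltr0n; near: n; exact: nbhs_infty_gt.
(* Since 1 - p k <= 1, the uncontaminated part of the variances adds at most n
   to their sum, that is 1/n after normalisation. *)
have up : (n%:R^-1 : R) + (n%:R ^+ 2)^-1 * (\sum_(1 <= k < n.+1) p k * sigma k ^+ 2)
    @[n --> \oo] --> (0 : R).
  by rewrite -[X in _ --> X]addr0; exact: (cvgD inv0 lim0).
apply: (squeeze_cvgr _ (cvg_cst 0) up).
near=> n.
have n0 : (0 < n)%N by near: n; exact: nbhs_infty_gt.
have kge1 k : k \in index_iota 1 n.+1 -> (1 <= k)%N.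
  by rewrite mem_index_iota => /andP[].
apply/andP; split.
  rewrite mulr_ge0 ?invr_ge0 ?sqr_ge0// big_seq sumr_ge0// => k /kge1 k1.
  have /andP[p0 p1] := p01 k k1.
  by rewrite addr_ge0 ?subr_ge0// (mulr_ge0 p0)// sqr_ge0.
rewrite big_split/= mulrDr lerD2r.
have nn0 : (n%:R : R) != 0 by rewrite pnatr_eq0 -lt0n.
have -> : (n%:R^-1 : R) = (n%:R ^+ 2)^-1 * n%:R by rewrite expr2 invfM mulfVK.
rewrite ler_wpM2l ?invr_ge0 ?sqr_ge0//.
apply: (@le_trans _ _ (\sum_(1 <= k < n.+1) 1)); last first.
  by rewrite sumr_const_nat subn1.
rewrite big_seq [leRHS]big_seq ler_sum// => k /kge1 k1.
by have /andP[p0 _] := p01 k k1; rewrite gerBl.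
Unshelve. all: by end_near.
Qed.
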